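(* Let $d\in\mathbb N$, $a\in\mathbb R$, $b\in[a,\infty)$, let $\mu\colon\mathcal B([a,b]^d)\to[0,\infty]$ be a measure, let $f\colon[a,b]^d\to\mathbb R$ be bounded and measurable, let $\sigma\colon\mathbb R\to\mathbb R$ be locally Lipschitz continuous and discriminatory for $\mu$, and let $D_h$, $\mathcal L_h\colon\mathbb R^{D_h}\to\mathbb R$ (assumed real-valued), $\mathbb I_h$ ($h\in\mathbb N_0$) and $\mathscr K\in\mathbb N_0\cup\{\infty\}$ be as defined in the context. Let $\alpha\in\mathbb R$, $\beta\in(\alpha,\infty)$ satisfy $\sigma(x)=\sigma(\alpha)$ for all $x\in(\alpha,\beta)$, let $H,n\in\mathbb N_0$ satisfy $n=\min\{H,\mathscr K\}$, and assume for all $h\in\{0,1,\dots,n\}$ that $(\mathcal L_h)^{-1}(\{\mathbb I_h\})\ne\emptyset$. Then there exist local minimum points $\vartheta_0,\vartheta_1,\dots,\vartheta_n\in\mathbb R^{D_H}$ of $\mathcal L_H$ such that $$\inf_{\xi\in\mathbb R}\int_{[a,b]^d}|f(x)-\xi|^2\,\mu(dx)\ge\mathbb I_0=\mathcal L_H(\vartheta_0)>\mathbb I_1=\mathcal L_H(\vartheta_1)>\dots>\mathbb I_n=\mathcal L_H(\vartheta_n)\ge0.$$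
   Context: For $h\in\mathbb N_0$ let $D_h=dh+2h+1$; for $\theta\in\mathbb R^{D_h}$, $x\in\mathbb R^d$ let $$\mathcal N_h^\theta(x)=\theta_{dh+2h+1}+\sum_{i=1}^h\theta_{dh+h+i}\,\sigma\Bigl(\theta_{dh+i}+\sum_{j=1}^d\theta_{(i-1)d+j}x_j\Bigr);$$ $\mathcal L_h(\theta)=\int_{[a,b]^d}(\mathcal N_h^\theta(x)-f(x))^2\,\mu(dx)$, where $\mathcal L_h\colon\mathbb R^{D_h}\to\mathbb R$ is assumed real-valued for every $h\in\mathbb N_0$ (so $\mu$ is finite); $\mathbb I_h=\inf_{\theta\in\mathbb R^{D_h}}\mathcal L_h(\theta)$; $\mathscr K=\inf(\{h\in\mathbb N_0\colon\mathbb I_h=0\}\cup\{\infty\})$. Discriminatory: for compact $K\subseteq\mathbb R^d$, a measure $\mu\colon\mathcal B(K)\to[0,\infty]$, and a locally bounded measurable $\sigma\colon\mathbb R\to\mathbb R$, $\sigma$ is discriminatory for $\mu$ if every measurable $\varphi\colon K\to\mathbb R$ with $\int_K|\varphi|\,d\mu<\infty$ and $\sup_{w\in\mathbb R^d}\sup_{c\in\mathbb R}\bigl|\int_K\sigma(\langle w,x\rangle+c)\varphi(x)\,\mu(dx)\bigr|=0$ satisfies $\int_K|\varphi|\,d\mu=0$. (Here $K=[a,b]^d$.) *)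

(* Defs.v *)
From mathcomp Require Import all_boot all_order all_algebra.
From mathcomp Require Import all_classical all_reals all_analysis.
Set Implicit Arguments.
Unset Strict Implicit.
Unset Printing Implicit Defensive.
Import Order.TTheory GRing.Theory Num.Theory.
Import numFieldNormedType.Exports.
Local Open Scope classical_set_scope.
Local Open Scope ring_scope.

(* R^d with its Borel sigma-algebra, generated by the open sets.  A measure on
   the Borel sets of a Borel set K is represented by a measure on [borelRd R d],
   and a function on K by a function on R^d; only integrals over K and
   measurability on K are ever used, so nothing depends on what happens
   outside K. *)
Definition borelRd (R : realType) (d : nat) :=
  g_sigma_algebraType (@open 'rV[R]_d).

Definition cube (R : realType) (d : nat) (a b : R) : set (borelRd R d) :=
  [set x : 'rV[R]_d | forall j : 'I_d, a <= x ord0 j <= b].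
Arguments cube {R} d a b.

Definition inner (R : realType) (d : nat) (w x : 'rV[R]_d) : R :=
  \sum_(j < d) w ord0 j * x ord0 j.

(* D_h = d h + 2 h + 1, in successor form so that [inord] applies. *)
Definition nparams (d h : nat) : nat := (d * h + 2 * h).+1.

(* [param theta k] is theta_(k+1) in 1-based numbering. *)
Definition param (R : realType) (D : nat) (theta : 'rV[R]_D.+1) (k : nat) : R :=
  theta ord0 (inord k).

(* With 0-based numbering: input weights at i * d + j, hidden biases at
   d h + i, output weights at d h + h + i, output bias at d h + 2 h. *)
Definition network (R : realType) (sigma : R -> R) (d h : nat)
    (theta : 'rV[R]_(nparams d h)) (x : 'rV[R]_d) : R :=
  param theta (d * h + 2 * h) +
  \sum_(i < h) param theta (d * h + h + i) *
    sigma (param theta (d * h + i) +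
           \sum_(j < d) param theta (i * d + j) * x ord0 j).

Section Risk.
Variables (R : realType) (d : nat) (a b : R).
Variables (mu : {measure set (borelRd R d) -> \bar R}).
Variables (f : borelRd R d -> R) (sigma : R -> R).

Definition risk_ereal (h : nat) (theta : 'rV[R]_(nparams d h)) : \bar R :=
  (\int[mu]_(x in cube d a b) ((network sigma theta x - f x) ^+ 2)%:E)%E.

(* The real-valued risk; [fine] is harmless when [risk_ereal] is finite. *)
Definition risk (h : nat) (theta : 'rV[R]_(nparams d h)) : R :=
  fine (risk_ereal theta).

Definition inf_risk (h : nat) : R := inf (range (@risk h)).

(* inf ({h | I_h = 0} U {oo}), as an extended real. *)
Definition zero_risk_width : \bar R :=
  ereal_inf ([set h%:R%:E | h in [set h : nat | inf_risk h = 0]]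
             `|` [set +oo%E]).

End Risk.

(* Intended for compact K and locally bounded measurable sigma, for which the
   inner integrals converge absolutely. *)
Definition discriminatory (R : realType) (d : nat) (K : set (borelRd R d))
    (mu : {measure set (borelRd R d) -> \bar R}) (sigma : R -> R) : Prop :=
  forall phi : borelRd R d -> R,
    measurable_fun K phi ->
    (\int[mu]_(x in K) `|phi x|%:E < +oo)%E ->
    ereal_sup (range (fun w : 'rV[R]_d => ereal_sup (range (fun c : R =>
      `| \int[mu]_(x in K) (sigma (inner w x + c) * phi x)%:E |%E)))) = 0%E ->
    (\int[mu]_(x in K) `|phi x|%:E = 0)%E.

Definition local_minimum_point (R : realType) (T : topologicalType)
    (F : T -> R) (t : T) : Prop :=
  \forall u \near t, F t <= F u.

(* Main.v *)
(** A minimizer of width h extends to width H by extra neurons with zero input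
    and output weights and bias in the middle of the flat interval.  Near this
    point the extra neurons remain constant on the cube, so that the network is
    realized by one of width h and the risk stays at least I_h: the extension
    is a local minimum point.  The infima decrease strictly while I_h > 0: if a
    minimizer of width h could not be improved by an extra neuron, the first
    variation in the output weight of that neuron would make the residual
    orthogonal to every sigma(<w, x> + c), and discriminatory sigma would force
    the residual to vanish almost everywhere. *)

Require Import Defs.
From mathcomp Require Import all_boot all_order all_algebra.
From mathcomp Require Import all_classical all_reals all_analysis.
From mathcomp Require Import measurable_realfun zify ring lra.
Import Order.TTheory GRing.Theory Num.Theory.
Import numFieldNormedType.Exports.
Local Open Scope classical_set_scope.
Local Open Scope ring_scope.

(** * Parameter vectors and changes of width *)

Lemma big_ord_split_at (R : nmodType) (h H : nat) (F : nat -> R) : (h <= H)%N ->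
  \sum_(i < H) F i = \sum_(i < h) F i + \sum_(h <= i < H) F i.
Proof. by move=> hH; rewrite -!(big_mkord predT) (@big_cat_nat _ _ _ h). Qed.

Section NetworkParams.
Context {R : realType} (sigma : R -> R) {d : nat}.

(** A right inverse of reading blocks with [param]: division with remainder by [d] decodes the
    weight index [i * d + j]. The blocks are functions on all of [nat], so the width can change
    without casts. *)
Definition pack (h : nat) (W : nat -> nat -> R) (c v : nat -> R) (e : R) :
    'rV[R]_(nparams d h) :=
  \row_k if (k < d * h)%N then W (k %/ d)%N (k %% d)%N
         else if (k < d * h + h)%N then c (k - d * h)%N
         else if (k < d * h + 2 * h)%N then v (k - (d * h + h))%N
         else e.

Section Pack.
Variables (h : nat) (W : nat -> nat -> R) (c v : nat -> R) (e : R).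

Lemma param_pack_weight (i j : nat) : (i < h)%N -> (j < d)%N ->
  param (pack h W c v e) (i * d + j) = W i j.
Proof.
move=> ih jd; have k_lt : (i * d + j < d * h)%N by nia.
rewrite /param mxE inordK; last by rewrite ltnS; lia.
by rewrite k_lt divnMDl ?modnMDl ?divn_small ?modn_small ?addn0//; lia.
Qed.

Lemma param_pack_bias (i : nat) : (i < h)%N ->
  param (pack h W c v e) (d * h + i) = c i.
Proof.
move=> ih; rewrite /param mxE inordK; last by rewrite ltnS; lia.
by rewrite ltnNge leq_addr/= ltn_add2l ih addKn.
Qed.

Lemma param_pack_output (i : nat) : (i < h)%N ->
  param (pack h W c v e) (d * h + h + i) = v i.
Proof.
move=> ih; rewrite /param mxE inordK; last by rewrite ltnS; lia.
do 2 (rewrite ifF; last by apply/negbTE; rewrite -leqNgt; lia).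
by rewrite ifT ?addKn//; lia.
Qed.

Lemma param_pack_const : param (pack h W c v e) (d * h + 2 * h) = e.
Proof.
rewrite /param mxE inordK//.
by do 3 (rewrite ifF; last by apply/negbTE; rewrite -leqNgt; lia).
Qed.

Lemma network_pack (x : 'rV[R]_d) :
  network sigma (pack h W c v e) x =
  e + \sum_(i < h) v i * sigma (c i + \sum_(j < d) W i j * x ord0 j).
Proof.
rewrite /network param_pack_const; congr (_ + _).
apply: eq_bigr => i _; rewrite param_pack_output// param_pack_bias//.
by under eq_bigr => j _ do rewrite param_pack_weight//.
Qed.

Lemma network_pack_split (l : nat) (x : 'rV[R]_d) : (l <= h)%N ->
  network sigma (pack h W c v e) x =
  e + \sum_(i < l) v i * sigma (c i + \sum_(j < d) W i j * x ord0 j) +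
      \sum_(l <= i < h) v i * sigma (c i + \sum_(j < d) W i j * x ord0 j).
Proof.
move=> lh; rewrite network_pack -addrA; congr (_ + _).
exact: (big_ord_split_at _ l h
  (fun i => v i * sigma (c i + \sum_(j < d) W i j * x ord0 j))).
Qed.

End Pack.

(** All new neurons share [w], [c] and [v]. [insub] turns the index [j] into a coordinate of [w];
    its default 0 is never reached for [j < d]. *)
Definition extend (h H : nat) (theta : 'rV[R]_(nparams d h))
    (w : 'rV[R]_d) (c v : R) : 'rV[R]_(nparams d H) :=
  pack H
    (fun i j => if (i < h)%N then param theta (i * d + j)
                else if insub j is Some k then w ord0 k else 0)
    (fun i => if (i < h)%N then param theta (d * h + i) else c)
    (fun i => if (i < h)%N then param theta (d * h + h + i) else v)
    (param theta (d * h + 2 * h)).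

(** The [H - h] added neurons are copies of each other, hence the multiple. With [v = 0] the
    function is kept; with [H = h + 1] one free neuron is added. *)
Lemma network_extend (h H : nat) (theta : 'rV[R]_(nparams d h))
    (w x : 'rV[R]_d) (c v : R) : (h <= H)%N ->
  network sigma (extend h H theta w c v) x =
  network sigma theta x + (v * sigma (inner w x + c)) *+ (H - h).
Proof.
move=> hH; rewrite (network_pack_split _ _ _ _ _ h)//; congr (_ + _).
  rewrite /network; congr (_ + _); apply: eq_bigr => i _.
  by rewrite ltn_ord.
rewrite -sumr_const_nat; apply: eq_big_nat => i /andP[hi _].
rewrite ltnNge hi/= (addrC c); congr (_ * sigma (_ + _)).
by apply: eq_bigr => j _; rewrite valK.
Qed.

(* [s] is the value at which the discarded neurons are constant. *)
Definition truncate (h H : nat) (u : 'rV[R]_(nparams d H)) (s : R) :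
    'rV[R]_(nparams d h) :=
  pack h (fun i j => param u (i * d + j)) (fun i => param u (d * H + i))
    (fun i => param u (d * H + H + i))
    (param u (d * H + 2 * H) + \sum_(h <= i < H) param u (d * H + H + i) * s).

(** A dropped neuron with activation [s] at [x] contributes its output weight times [s], which
    [truncate] moves into the output bias. *)
Lemma network_truncate (h H : nat) (u : 'rV[R]_(nparams d H)) (s : R)
    (x : 'rV[R]_d) : (h <= H)%N ->
  (forall i, (h <= i < H)%N -> sigma (param u (d * H + i) +
     \sum_(j < d) param u (i * d + j) * x ord0 j) = s) ->
  network sigma (truncate h H u s) x = network sigma u x.
Proof.
move=> hH us; rewrite network_pack /network.
rewrite (big_ord_split_at _ h H (fun i => param u (d * H + H + i) *
  sigma (param u (d * H + i) +
     \sum_(j < d) param u (i * d + j) * x ord0 j)) hH).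
rewrite -!addrA; congr (_ + _); rewrite addrC; congr (_ + _).
by apply: eq_big_nat => i hi; rewrite us.
Qed.

End NetworkParams.

(** * Continuity and measurability *)

Lemma locally_lipschitz_continuous (R : realType) (s : R -> R) :
  [locally [lipschitz s x | x in [set: R]]] -> continuous s.
Proof.
move=> lips x; have /(_ (conj I I)) := lips (x, x).
move=> /pinfty_ex_gt0[M M_gt0] /nbhs_ballP[e /= e_gt0 sM].
apply/cvgrPdist_lt => r r_gt0; near=> y.
have xy : `|x - y| < e by near: y; apply: cvgr_dist_lt.
have /= := sM (x, y) (conj (ballxx _ e_gt0) xy) (conj I I).
move=> /le_lt_trans; apply; rewrite mulrC -ltr_pdivlMr//.
near: y; apply: cvgr_dist_lt; last exact: divr_gt0.
exact: cvg_id.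
Unshelve. all: by end_near. Qed.

(** Open intervals generate the Borel sets of [R], and their preimages under a coordinate are open
    by continuity. *)
Lemma measurable_coord (R : realType) (d : nat) (j : 'I_d) :
  measurable_fun setT (fun x : borelRd R d => (x : 'rV[R]_d) ord0 j).
Proof.
apply: (measurability _ (RGenOpens.measurableE R)).
move=> _ [_ [p [q ->] <-]]; rewrite setTI; apply: sub_sigma_algebra.
have /continuousP := @coord_continuous R 1 d ord0 j; apply.
exact: interval_open.
Qed.

Lemma measurable_cube (R : realType) (d : nat) (a b : R) :
  measurable (cube d a b).
Proof.
rewrite (_ : cube d a b = \bigcap_(j in [set: 'I_d])
  ((fun x : borelRd R d => (x : 'rV[R]_d) ord0 j) @^-1` `[a, b])); last first.
  apply/seteqP; split => [x xab j _|x xab j] /=.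
    by rewrite in_itv/=; exact: xab.
  by have := xab j I; rewrite /= in_itv.
apply: fin_bigcap_measurable => // j _.
by rewrite -[X in measurable X]setTI; exact: measurable_coord.
Qed.

Lemma measurable_inner (R : realType) (d : nat) (w : nat -> R) :
  measurable_fun setT
    (fun x : borelRd R d => \sum_(j < d) w j * (x : 'rV[R]_d) ord0 j).
Proof.
apply: measurable_sum => j.
apply: measurable_funM; [exact: measurable_cst|exact: measurable_coord].
Qed.

Lemma measurable_network (R : realType) (sigma : R -> R) (d h : nat)
    (theta : 'rV[R]_(nparams d h)) : continuous sigma ->
  measurable_fun setT (network sigma theta : borelRd R d -> R).
Proof.
move=> /continuous_measurable_fun ms; apply: measurable_funD => //.
apply: measurable_sum => i; apply: measurable_funM => //.
apply: measurableT_comp => //; apply: measurable_funD => //.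
exact: (measurable_inner R d (fun j => param theta (i * d + j))).
Qed.

(** Collapses the nested suprema in [discriminatory] once every integral vanishes; pointedness of
    [T] makes the range nonempty. *)
Lemma ereal_sup_range_cst (R : realType) (T : pointedType) (F : T -> \bar R)
    (c : \bar R) : (forall t, F t = c) -> ereal_sup (range F) = c.
Proof.
move=> Fc; rewrite -[RHS]ereal_sup1; congr ereal_sup.
apply/seteqP; split=> [_ [t _ <-]|_ ->]; first exact: Fc.
by exists point => //; exact: Fc.
Qed.

(** * Square integrals and the first variation *)

Section SquareIntegrals.
Context {d : measure_display} {T : measurableType d} {R : realType}.
Variables (mu : {measure set T -> \bar R}) (D : set T).
Hypothesis mD : measurable D.

Lemma integrable_sqr (g : T -> R) : measurable_fun D g ->
  (\int[mu]_(x in D) (g x ^+ 2)%:E)%E \is a fin_num ->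
  mu.-integrable D (EFin \o (fun x => g x ^+ 2)).
Proof.
move=> mg fing; apply/integrableP.
have mg2 : measurable_fun D (fun x => g x ^+ 2) by exact: measurable_funX.
split; first exact/measurable_EFinP.
by rewrite /= integral_fin_num_abs.
Qed.

Lemma sqr_integral_eq0 (g : T -> R) : measurable_fun D g ->
  (\int[mu]_(x in D) `|g x|%:E = 0)%E ->
  (\int[mu]_(x in D) (g x ^+ 2)%:E = 0)%E.
Proof.
move=> mg g0.
have mg' : measurable_fun D (EFin \o g) by exact/measurable_EFinP.
have mg2 : measurable_fun D (EFin \o (fun x => g x ^+ 2)).
  by apply/measurable_EFinP; exact: measurable_funX.
have g_ae := (ae_eq_integral_abs mu mD mg').1 g0.
rewrite -[RHS](integral0 mu D); apply: ae_eq_integral => //.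
by apply: filterS g_ae => x gx Dx; move: (gx Dx) => /= [->]; rewrite expr0n.
Qed.

Lemma integrable_lincomb (u v : T -> R) (r t : R) :
  mu.-integrable D (EFin \o u) -> mu.-integrable D (EFin \o v) ->
  mu.-integrable D (EFin \o (fun x => r * u x + t * v x)).
Proof.
move=> iu iv; rewrite (_ : _ \o _ =
  (fun x => r%:E * (EFin \o u) x + t%:E * (EFin \o v) x)%E).
  by apply: integrableD => //; exact: integrableZl.
by apply/funext => x /=; rewrite EFinD !EFinM.
Qed.

(** In [v], the perturbed integral is a quadratic polynomial minimal at 0, so its linear
    coefficient, twice the integral of [s * g], vanishes. *)
Lemma first_variation (g s : T -> R) :
  measurable_fun D g -> measurable_fun D s ->
  (forall v : R,
     (\int[mu]_(x in D) ((g x + v * s x) ^+ 2)%:E)%E \is a fin_num) ->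
  (forall v : R, (\int[mu]_(x in D) (g x ^+ 2)%:E <=
                  \int[mu]_(x in D) ((g x + v * s x) ^+ 2)%:E)%E) ->
  (\int[mu]_(x in D) (s x * g x)%:E = 0)%E.
Proof.
move=> mg ms fin min.
have mgs v : measurable_fun D (fun x => g x + v * s x).
  by apply: measurable_funD => //; exact: measurable_funM.
have intZ c u : mu.-integrable D (EFin \o u) ->
    mu.-integrable D (EFin \o (fun x => c * u x)).
  move=> iu; have := integrable_lincomb _ _ c 0 iu iu.
  by congr integrable; apply/funext => x /=; rewrite mul0r addr0.
have int v := integrable_sqr _ (mgs v) (fin v).
have intg : mu.-integrable D (EFin \o (fun x => g x ^+ 2)).
  have := int 0; congr integrable; apply/funext => x /=.
  by rewrite mul0r addr0.
(* Polarization turns the finiteness hypotheses into integrability of the cross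
   term and of [s ^+ 2]. *)
have intsg : mu.-integrable D (EFin \o (fun x => s x * g x)).
  have := integrable_lincomb _ _ 4^-1 (- 4^-1) (int 1) (int (-1)).
  by congr integrable; apply/funext => x /=; congr EFin; field.
have ints : mu.-integrable D (EFin \o (fun x => s x ^+ 2)).
  have := integrable_lincomb _ _ 2^-1 1
    (integrable_lincomb _ _ 1 1 (int 1) (int (-1)))
    (integrable_lincomb _ _ (-1) 0 intg intg).
  by congr integrable; apply/funext => x /=; congr EFin; field.
set P := \int[mu]_(x in D) (s x * g x).
set Q := \int[mu]_(x in D) (s x ^+ 2).
have Q0 : 0 <= Q by apply: Rintegral_ge0 => x _; exact: sqr_ge0.
have min' v : 0 <= v * (2 * P) + v ^+ 2 * Q.
  have eqI : \int[mu]_(x in D) ((g x + v * s x) ^+ 2) =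
      \int[mu]_(x in D) (g x ^+ 2) + (v * (2 * P) + v ^+ 2 * Q).
    have intD := integrable_lincomb _ _ (v * 2) (v ^+ 2) intsg ints.
    rewrite mulrA -(RintegralZl (v * 2) mD intsg).
    rewrite -(RintegralZl (v ^+ 2) mD ints).
    rewrite -(RintegralD mD (intZ _ _ intsg) (intZ _ _ ints)).
    rewrite -(RintegralD mD intg intD).
    by apply: eq_Rintegral => x _; ring.
  rewrite -(lerDl (\int[mu]_(x in D) (g x ^+ 2))) -eqI.
  apply: fine_le (min v); [|exact: fin].
  exact: integrable_fin_num.
have P0 : P = 0.
  (* The minimum of the quadratic, with [Q + 1] to allow [Q = 0]. *)
  have /= := min' (- P / (Q + 1)).
  have Q1 : 0 < Q + 1 by lra.
  rewrite (_ : _ + _ = - (P ^+ 2 * (Q + 2) / (Q + 1) ^+ 2)).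
    rewrite oppr_ge0 pmulr_lle0 ?invr_gt0 ?exprn_gt0//.
    rewrite pmulr_lle0; last lra.
    by move=> P2; apply/eqP; rewrite -sqrf_eq0 eq_le P2 sqr_ge0.
  by field; lra.
by rewrite -(fineK (integrable_fin_num mD intsg)) -/(Rintegral _ _ _) -/P P0.
Qed.

End SquareIntegrals.

(** * Risks, their infima and local minima *)

Section RiskLandscape.
Context {R : realType} {d : nat} (a b : R).
Context (mu : {measure set (borelRd R d) -> \bar R}).
Context (f : borelRd R d -> R) (sigma : R -> R).
Hypothesis f_meas : measurable_fun (cube d a b) f.
Hypothesis sigma_cont : continuous sigma.
Hypothesis risk_fin : forall (h : nat) (theta : 'rV[R]_(nparams d h)),
  risk_ereal a b mu f sigma theta \is a fin_num.

Notation loss h := (risk a b mu f sigma (h := h)).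
Notation best h := (inf_risk a b mu f sigma h).

Lemma risk_ge0 (h : nat) (theta : 'rV[R]_(nparams d h)) : 0 <= loss h theta.
Proof.
by apply: fine_ge0; apply: integral_ge0 => x _; rewrite lee_fin sqr_ge0.
Qed.

(** Nonemptiness and the lower bound 0 make [inf] a true infimum rather than a default value. *)
Lemma has_inf_risk (h : nat) : has_inf (range (loss h)).
Proof.
split; first by exists (loss h 0), 0.
by exists 0 => _ [theta _ <-]; exact: risk_ge0.
Qed.

Lemma inf_risk_le (h : nat) (theta : 'rV[R]_(nparams d h)) :
  best h <= loss h theta.
Proof. by apply: ge_inf; [exact: (has_inf_risk h).2|exists theta]. Qed.

Lemma inf_risk_ge0 (h : nat) : 0 <= best h.
Proof.
by apply: lb_le_inf => [|_ [theta _ <-]];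
  [exact: (has_inf_risk h).1|exact: risk_ge0].
Qed.

(** The risk sees only the function realized on the cube, so parameters of different widths can be
    compared. *)
Lemma eq_risk (h k : nat) (theta : 'rV[R]_(nparams d h))
    (eta : 'rV[R]_(nparams d k)) :
  {in cube d a b, network sigma theta =1 network sigma eta} ->
  loss h theta = loss k eta.
Proof.
move=> eq_net; rewrite /risk /risk_ereal; congr fine.
by apply: eq_integral => x xK; rewrite eq_net.
Qed.

Lemma risk_extend0 (h H : nat) (theta : 'rV[R]_(nparams d h))
    (w : 'rV[R]_d) (c : R) : (h <= H)%N ->
  loss H (extend h H theta w c 0) = loss h theta.
Proof.
move=> hH; apply: eq_risk => x _.
by rewrite network_extend// mul0r mul0rn addr0.
Qed.

(** The constant network [M + 1] exceeds [f] by at least 1 on the cube, so its finite risk bounds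
    the measure. *)
Lemma cube_mu_fin : [bounded f x | x in cube d a b] ->
  (mu (cube d a b) < +oo)%E.
Proof.
move=> /pinfty_ex_gt0[M M_gt0 fM].
pose theta : 'rV[R]_(nparams d 0) :=
  pack 0 (fun _ _ => 0) (fun=> 0) (fun=> 0) (M + 1).
have := risk_fin _ theta; rewrite ge0_fin_numE; last first.
  by apply: integral_ge0 => x _; rewrite lee_fin sqr_ge0.
have mK := measurable_cube R d a b.
apply: le_lt_trans; rewrite -[leLHS]mul1e -(integral_cst mu mK).
apply: ge0_le_integral => //.
- apply/measurable_EFinP; apply: measurable_funX; apply: measurable_funB => //.
  by apply: measurable_funTS; exact: measurable_network.
- move=> x Kx; rewrite network_pack big_ord0 addr0 lee_fin.
  have : `|f x| <= M by exact: fM.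
  by rewrite ler_norml => /andP[_ fxM]; nra.
Qed.

Lemma inf_risk_decreasing (h : nat) (theta : 'rV[R]_(nparams d h)) :
  [bounded f x | x in cube d a b] ->
  discriminatory (cube d a b) mu sigma ->
  loss h theta = best h -> best h != 0 -> best h.+1 < best h.
Proof.
(* By contraposition: if width [h + 1] is no better, then [best h] is 0. *)
move=> f_bnd discr theta_min; rewrite ltNge; apply: contra => le_best.
have mK := measurable_cube R d a b.
pose phi x := network sigma theta x - f x.
have mphi : measurable_fun (cube d a b) phi.
  apply: measurable_funB => //; apply: measurable_funTS.
  exact: measurable_network.
have phi2_fin : (\int[mu]_(x in cube d a b) (phi x ^+ 2)%:E)%E \is a fin_num.
  exact: risk_fin.
have mneuron (w : 'rV[R]_d) (c : R) :
    measurable_fun (cube d a b) (fun x : borelRd R d => sigma (inner w x + c)).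
  apply: measurable_funTS; apply: measurableT_comp.
    exact: continuous_measurable_fun.
  apply: measurable_funD => //; apply: measurable_sum => j.
  by apply: measurable_funM => //; exact: measurable_coord.
have extE w c v : risk_ereal a b mu f sigma (extend h h.+1 theta w c v) =
    (\int[mu]_(x in cube d a b)
       ((phi x + v * sigma (inner w x + c)) ^+ 2)%:E)%E.
  apply: eq_integral => x _; rewrite network_extend// subSnn mulr1n.
  by rewrite /phi addrAC.
have orth w c :
    (\int[mu]_(x in cube d a b) (sigma (inner w x + c) * phi x)%:E = 0)%E.
  apply: first_variation => // v; rewrite -extE; first exact: risk_fin.
  (* The extended network has risk at least [best h.+1], hence at least [best h], the risk of
     [theta]. *)
  rewrite -(fineK phi2_fin) -(fineK (risk_fin _ _)) lee_fin.
  apply: le_trans (inf_risk_le _ _).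
  by rewrite -[leLHS]/(loss h theta) theta_min.
have phi0 : (\int[mu]_(x in cube d a b) `|phi x|%:E = 0)%E.
  apply: discr => //.
    (* Since [|phi| <= 1 + phi^2], square integrability and the finite measure of the cube make
       [phi] integrable. *)
    apply: (@le_lt_trans _ _
      (\int[mu]_(x in cube d a b) (1 + phi x ^+ 2)%:E)%E).
      apply: ge0_le_integral => //.
      + by apply/measurable_EFinP; exact: measurableT_comp.
      + apply/measurable_EFinP; apply: measurable_funD => //.
        exact: measurable_funX.
      + move=> x _; rewrite lee_fin.
        rewrite -[X in _ <= _ + X]real_normK; last exact: num_real.
        have := sqr_ge0 (`|phi x| - 1); nra.
    under eq_integral do rewrite EFinD.
    rewrite ge0_integralD//; last 2 first.
    + by move=> x _; rewrite lee_fin sqr_ge0.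
    + by apply/measurable_EFinP; exact: measurable_funX.
    rewrite integral_cst// mul1e lte_add_pinfty//; first exact: cube_mu_fin.
    by rewrite ltey_eq phi2_fin.
  by do 2 apply: ereal_sup_range_cst => ?; rewrite orth abse0.
have := sqr_integral_eq0 mu _ mK phi mphi phi0.
by rewrite -theta_min /risk /risk_ereal => ->.
Qed.

Lemma local_minimum_extend (h H : nat) (theta : 'rV[R]_(nparams d h))
    (alpha beta : R) : alpha < beta ->
  (forall x : R, alpha < x < beta -> sigma x = sigma alpha) ->
  (h <= H)%N -> loss h theta = best h ->
  local_minimum_point (loss H) (extend h H theta 0 ((alpha + beta) / 2) 0).
Proof.
move=> ab flat hH theta_min.
(* [B] bounds the absolute value of every coordinate on the cube. *)
pose B := `|a| + `|b|.
have B_ge0 : 0 <= B by rewrite addr_ge0.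
have dB_gt0 : 0 < 1 + d%:R * B by rewrite ltr_wpDr// mulr_ge0.
(* A perturbation below [e] shifts the input of [sigma] in an extra neuron by less than [e] through
   the bias and by at most [e * d * B] through the weights: in total less than half the flat
   interval, starting from its midpoint. *)
pose e := (beta - alpha) / 2 / (1 + d%:R * B).
have e_gt0 : 0 < e by rewrite !divr_gt0// subr_gt0.
apply/nbhs_ballP; exists e => //= u [_ tu].
have near_param k :
    `|param (extend h H theta 0 ((alpha + beta) / 2) 0) k - param u k| < e.
  exact: tu.
rewrite risk_extend0// theta_min.
apply: le_trans (inf_risk_le _ (truncate h H u (sigma alpha))) _.
(* Equality holds, as [u] and its truncation realize the same function on the cube. *)
rewrite le_eqVlt; apply/orP; left; apply/eqP.
apply: eq_risk => x; rewrite inE => xK.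
apply: network_truncate => // i /andP[hi iH].
apply: flat; have := near_param (d * H + i)%N.
rewrite /extend param_pack_bias// ltnNge hi/= => bias_near.
have sum_le : `|\sum_(j < d) param u (i * d + j) * x ord0 j| <= e * (d%:R * B).
  apply: (le_trans (ler_norm_sum _ _ _)).
  rewrite mulrCA -[X in X%:R * _]card_ord -sum1_card natr_sum mulr_suml.
  apply: ler_sum => j _; rewrite mul1r normrM; apply: ler_pM => //.
    have := near_param (i * d + j)%N; rewrite param_pack_weight// ltnNge hi/=.
    by rewrite valK mxE sub0r normrN => /ltW.
  have /andP[ax xb] := xK j; rewrite ler_norml; apply/andP; split.
    by have := ler_norm (- a); rewrite normrN /B; have := normr_ge0 b; lra.
  by have := ler_norm b; rewrite /B; have := normr_ge0 a; lra.
have eE : e * (1 + d%:R * B) = (beta - alpha) / 2.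
  by rewrite /e divfK// gt_eqF.
move: bias_near sum_le; rewrite ltr_norml ler_norml => /andP[? ?] /andP[? ?].
apply/andP; split; lra.
Qed.

End RiskLandscape.

(** * Construction of the chain of local minimum points *)

Theorem corollary3p14 (R : realType) (d : nat) (d_gt0 : (0 < d)%N)
  (a b : R) (le_ab : a <= b)
  (mu : {measure set (borelRd R d) -> \bar R})
  (f : borelRd R d -> R)
  (f_bounded : [bounded f x | x in cube d a b])
  (f_measurable : measurable_fun (cube d a b) f)
  (sigma : R -> R)
  (sigma_loclip : [locally [lipschitz sigma x | x in [set: R]]])
  (sigma_discr : discriminatory (cube d a b) mu sigma)
  (risk_fin : forall (h : nat) (theta : 'rV[R]_(nparams d h)),
     risk_ereal a b mu f sigma theta \is a fin_num)
  (alpha beta : R) (lt_alpha_beta : alpha < beta)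
  (sigma_flat : forall x : R, alpha < x < beta -> sigma x = sigma alpha)
  (H n : nat)
  (n_def : n%:R%:E = Order.min H%:R%:E (zero_risk_width a b mu f sigma))
  (min_attained : forall h : nat, (h <= n)%N ->
     risk a b mu f sigma (h := h) @^-1` [set inf_risk a b mu f sigma h] !=set0) :
  exists vartheta : 'I_n.+1 -> 'rV[R]_(nparams d H),
    [/\ forall i : 'I_n.+1,
          local_minimum_point (risk a b mu f sigma (h := H)) (vartheta i),
        ((inf_risk a b mu f sigma 0)%:E <=
          ereal_inf (range (fun xi : R =>
            \int[mu]_(x in cube d a b) (`|f x - xi| ^+ 2)%:E)))%E,
        forall i : 'I_n.+1,
          inf_risk a b mu f sigma i = risk a b mu f sigma (vartheta i),
        forall i : nat, (i < n)%N ->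
          inf_risk a b mu f sigma i.+1 < inf_risk a b mu f sigma i &
        0 <= inf_risk a b mu f sigma n].
Proof.
have sigma_cont := locally_lipschitz_continuous R sigma sigma_loclip.
have [n_le_H n_le_K] : (n <= H)%N /\
    (n%:R%:E <= zero_risk_width a b mu f sigma)%E.
  have n_le : (n%:R%:E <= H%:R%:E :> \bar R)%E by rewrite n_def ge_min lexx.
  by split; [rewrite lee_fin ler_nat in n_le|rewrite n_def ge_min lexx orbT].
have min_ex (i : 'I_n.+1) : exists theta : 'rV[R]_(nparams d i),
    risk a b mu f sigma theta = inf_risk a b mu f sigma i.
  by have [theta] := min_attained i (ltn_ord i); exists theta.
pose theta i := projT1 (cid (min_ex i)).
have thetaE i : risk a b mu f sigma (theta i) = inf_risk a b mu f sigma i.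
  exact: projT2 (cid (min_ex i)).
have i_le_H (i : 'I_n.+1) : (i <= H)%N.
  by rewrite (leq_trans _ n_le_H)// -ltnS.
exists (fun i : 'I_n.+1 => extend i H (theta i) 0 ((alpha + beta) / 2) 0).
split.
- by move=> i; exact: local_minimum_extend.
- apply: le_ereal_inf_tmp => _ [xi _ <-].
  (* A network of width 0 is just its output bias, here [xi]. *)
  pose eta : 'rV[R]_(nparams d 0) :=
    pack 0 (fun _ _ => 0) (fun=> 0) (fun=> 0) xi.
  rewrite (_ : integral _ _ _ = risk_ereal a b mu f sigma eta); last first.
    apply: eq_integral => x _; rewrite real_normK ?num_real//.
    by rewrite network_pack big_ord0 addr0 -sqrrN opprB.
  by rewrite -(fineK (risk_fin _ _)) lee_fin; exact: inf_risk_le.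
- by move=> i; rewrite risk_extend0// thetaE.
- move=> i i_lt_n; have i_lt : (i < n.+1)%N by exact: ltnW.
  apply: (inf_risk_decreasing _ _ _ _ _ _ _ _ i (theta (Ordinal i_lt))) => //.
  - exact: thetaE (Ordinal i_lt).
  (* If the infimum at width [i] were 0, then [zero_risk_width] would be at most [i], so
     [n <= i]. *)
  apply: contraTneq i_lt_n => I_i0; rewrite -leqNgt -(ler_nat R) -lee_fin.
  by apply: le_trans n_le_K _; apply: ereal_inf_lbound; left; exists i.
- exact: inf_risk_ge0.
Qed.
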